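(* For every positive integer $n$: (a) $\mathcal{J}^*_6(2n)$ and $\mathcal{J}_6(2n)$ are even; (b) $\mathcal{J}_6(4n+1)$ is even; (c) $\mathcal{J}^*_6(24n+11)$, $\mathcal{J}^*_6(24n+19)$, $\mathcal{J}_6(24n+11)$ and $\mathcal{J}_6(24n+19)$ are even; (d) $\mathcal{J}^*_6(4n-1)\equiv \mathcal{J}_6(4n-1)\pmod 2$; (e) $\mathcal{J}^*_6(8n+1)\equiv \mathcal{J}_6(24n+3)\pmod 2$.
   Context: Let $q=e^{2\pi i\tau}$, $(a;q)_\infty=\prod_{j\ge0}(1-aq^j)$, and $\eta(\tau)=q^{1/24}(q;q)_\infty$. Define the Hauptmoduln $$j_6(\tau)=\left(\frac{\eta(2\tau)\eta(3\tau)^3}{\eta(\tau)\eta(6\tau)^3}\right)^3-3=\frac1q+\sum_{n\ge0}\mathcal{J}_6(n)q^n,$$ $$j_6^{*}(\tau)=\left(\frac{\eta(\tau)\eta(3\tau)}{\eta(2\tau)\eta(6\tau)}\right)^6+6+2^6\left(\frac{\eta(2\tau)\eta(6\tau)}{\eta(\tau)\eta(3\tau)}\right)^6 = \frac1q+\sum_{n\ge 0}\mathcal{J}^*_6(n)q^n.$$ *)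

(* Defs.v *)
(* q-expansions are computed exactly via truncated products. *)
From mathcomp Require Import all_boot all_order all_algebra.
Set Implicit Arguments. Unset Strict Implicit. Unset Printing Implicit Defensive.
Import Order.TTheory GRing.Theory Num.Theory.
Local Open Scope ring_scope.

(* Truncation of (q^k;q^k)_oo = prod_{j>=1} (1 - q^{k j}) keeping factors j <= N.
   For k >= 1 its coefficients of q^m, m <= N, are exact. *)
Definition qpoch_tr (k N : nat) : {poly int} :=
  \prod_(1 <= j < N.+1) (1 - 'X^(k * j)).

(* Truncation of 1/(q^k;q^k)_oo = prod_{j>=1} sum_{i>=0} q^{k j i}, keeping
   j <= N and i <= N; exact for coefficients of q^m, m <= N (k >= 1). *)
Definition qpochinv_tr (k N : nat) : {poly int} :=
  \prod_(1 <= j < N.+1) \sum_(i < N.+1) 'X^(k * j * i).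

(* P(q) = ((q^2;q^2)(q^3;q^3)^3 / ((q;q)(q^6;q^6)^3))^3, so j_6 + 3 = q^{-1} P(q). *)
Definition P6_tr (N : nat) : {poly int} :=
  (qpoch_tr 2 N * qpoch_tr 3 N ^+ 3 * qpochinv_tr 1 N * qpochinv_tr 6 N ^+ 3) ^+ 3.

(* A(q) = ((q;q)(q^3;q^3) / ((q^2;q^2)(q^6;q^6)))^6 : the first term of j_6^* is q^{-1} A(q). *)
Definition A6_tr (N : nat) : {poly int} :=
  (qpoch_tr 1 N * qpoch_tr 3 N * qpochinv_tr 2 N * qpochinv_tr 6 N) ^+ 6.

(* A(q)^{-1} : the last term of j_6^* is 2^6 q A(q)^{-1}. *)
Definition A6inv_tr (N : nat) : {poly int} :=
  (qpoch_tr 2 N * qpoch_tr 6 N * qpochinv_tr 1 N * qpochinv_tr 3 N) ^+ 6.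

(* coefficient of q^m in the series whose N-th truncation is f N *)
Definition qcoef (f : nat -> {poly int}) (m : nat) : int := (f m)`_m.

(* J_6(n): coefficient of q^n in j_6 = q^{-1} P(q) - 3 *)
Definition J6 (n : nat) : int :=
  qcoef P6_tr n.+1 - (if n == 0%N then 3 else 0).

(* J_6^*(n): coefficient of q^n in j_6^* = q^{-1} A(q) + 6 + 64 q A(q)^{-1} *)
Definition J6star (n : nat) : int :=
  qcoef A6_tr n.+1 + (if n == 0%N then 6 else 0)
  + (if n is m.+1 then 64 * qcoef A6inv_tr m else 0).

(* Main.v *)
(* Write [f_k] for [(q^k;q^k)_oo] and work modulo 2, where [f_{2k} = f_k^2].
   Put [a = f_1^3 = sum_k q^(k(k+1)/2)] and [b = f_3^3 = a(q^3)].  Everything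
   follows from the identity [a b = a^4 + q b^4], which holds because a rotation
   pairs off the representations of an integer by [x^2 + 3 y^2], [x] and [y] odd.
   Indeed [q j_6 = a / b^3] (up to the constant term of [j_6]) and
   [q j_6^* = (a b)^(-2)]; with [W = a / b] and [V = b / a] the identity reads
     [a / b^3 = W^4 + q],      [(a b)^(-2) = W^4 + q^2 V^4],
     [W = (a^2 / b)^2 + q b^2], [V = a^2 + q (b^2 / a)^2],
   and squares are series in [q^2].  So the odd part of [W] is [q a(q^6)], and
   the even part of [V] is [a(q^2)]. *)
Require Import Defs.
From mathcomp Require Import all_boot all_order all_algebra.
From mathcomp Require Import zify ring.
Set Implicit Arguments. Unset Strict Implicit. Unset Printing Implicit Defensive.
Import GRing.Theory.
Local Open Scope ring_scope.

(** * Characteristic 2 and truncation of power series *)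

Lemma addFF (x : 'F_2) : x + x = 0.
Proof. by apply: addrr_pchar2; apply: pchar_Fp. Qed.

Lemma addpp (p : {poly 'F_2}) : p + p = 0.
Proof. by apply/polyP=> i; rewrite coefD coef0 addFF. Qed.

Lemma dvd2zE (z : int) : (2 %| z)%Z = (z%:~R == 0 :> 'F_2).
Proof. by apply: dvdz_pcharf; apply: pchar_Fp. Qed.

(** Frobenius: the cross term is doubled, hence zero, and constants satisfy [c^2 = c] in ['F_2]. *)
Lemma sqr_comp_polyX2 (p : {poly 'F_2}) : p ^+ 2 = p \Po 'X^2.
Proof.
elim/poly_ind: p => [|p c IHp]; first by rewrite comp_poly0 expr0n.
rewrite comp_polyD comp_polyM comp_polyX comp_polyC -IHp sqrrD mulr2n addpp addr0.
rewrite exprMn -polyC_exp; congr (_ + _%:P).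
by apply: val_inj; case: c => [[|[|]]].
Qed.

Lemma coef_sqr (p : {poly 'F_2}) i :
  (p ^+ 2)`_i = if (2 %| i)%N then p`_(i %/ 2) else 0.
Proof. by rewrite sqr_comp_polyX2 coef_comp_poly_Xn. Qed.

Lemma coef_pow4 (p : {poly 'F_2}) i :
  (p ^+ 4)`_i = if (4 %| i)%N then p`_(i %/ 4) else 0.
Proof.
rewrite -[X in _ ^+ X]/(2 * 2)%N exprM !coef_sqr.
case: (boolP (2 %| i)%N) => [/dvdnP[j ->]|ndvd2].
  by rewrite mulnK // -[4%N]/(2 * 2)%N dvdn_pmul2r // divnMr.
by rewrite ifN //; apply: contra ndvd2; apply: dvdn_trans.
Qed.

(** Modulo [X^(n+1)] the truncated Euler products are units, so eta quotients can be treated by ring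
    identities. *)
Local Notation trunc n := (in_qpoly ('X^(n.+1) : {poly 'F_2})).

Lemma val_trunc n p : trunc n p = take_poly n.+1 p :> {poly 'F_2}.
Proof.
rewrite /= mk_monic_Xn /=.
rewrite [in LHS](_ : p = drop_poly n.+1 p * 'X^(n.+1) + take_poly n.+1 p); last first.
  by rewrite addrC poly_take_drop.
rewrite Pdiv.RingMonic.rmodp_addl_mul_small ?monicXn //.
by rewrite size_polyXn ltnS size_take_poly.
Qed.

Lemma truncP n p q : trunc n p = trunc n q <-> (forall i, (i <= n)%N -> p`_i = q`_i).
Proof.
split=> [/(congr1 (@polyn _ _)) eq_pq i le_in | eq_pq].
  move: eq_pq; rewrite !val_trunc.
  by move/(congr1 (fun r : {poly _} => r`_i)); rewrite !coef_take_poly ltnS le_in.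
apply: val_inj; rewrite -![val _]/(polyn _) !val_trunc.
apply/polyP=> i; rewrite !coef_take_poly ltnS.
by case: ifP => // le_in; apply: eq_pq.
Qed.

Lemma truncXn n k : (n < k)%N -> trunc n 'X^k = 0.
Proof.
move=> lt_nk; rewrite -(rmorph0 (trunc n)); apply/truncP=> i le_in.
by rewrite coefXn coef0 ltn_eqF // (leq_ltn_trans le_in).
Qed.

(** * Gauss's series for triangular numbers *)

(* Shanks' finite form of [sum_k x^(k(k+1)/2) = prod_k (1-x^(2k)) / (1-x^(2k-1))],
   which needs no limit: modulo [x^(n+1)] only the term [s = 0] survives. *)
Section Shanks.
Variables (R : comPzRingType) (x : R).

Local Notation odds a := (\prod_(0 <= k < a) (1 - x ^+ (2 * k + 1))).
Local Notation evens a b := (\prod_(a <= k < b) (1 - x ^+ (2 * k + 2))).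

Lemma shanks n :
  (\sum_(0 <= k < 2 * n) x ^+ 'C(k.+1, 2)) * odds n =
  \sum_(0 <= s < n) evens s n * odds s * x ^+ (s * (2 * n + 1)).
Proof.
elim: n => [|n IHn]; first by rewrite muln0 !big_geq // mul0r.
pose U s := (1 - x ^+ (2 * s)) * evens s n * odds s * x ^+ (s * (2 * n + 1)).
have step s : (0 <= s < n)%N ->
    evens s n.+1 * odds s * x ^+ (s * (2 * n.+1 + 1)) =
    (1 - x ^+ (2 * n + 1)) * (evens s n * odds s * x ^+ (s * (2 * n + 1)))
    + (U s.+1 - U s).
  move=> /andP[_ lt_sn]; rewrite /U (big_nat_recr n) ?(ltnW lt_sn) //=.
  rewrite (big_ltn lt_sn) (big_nat_recr s) //=.
  have -> : (s * (2 * n.+1 + 1) = s * (2 * n + 1) + 2 * s)%N by lia.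
  have -> : (s.+1 * (2 * n + 1) = s * (2 * n + 1) + (2 * n + 1))%N by lia.
  have -> : (2 * s.+1 = 2 * s + 2)%N by lia.
  rewrite !exprD expr1.
  ring.
rewrite [RHS]big_nat_recr // (eq_big_nat _ _ step).
rewrite big_split /= -big_distrr -IHn telescope_sumr //.
have -> : \sum_(0 <= k < 2 * n.+1) x ^+ 'C(k.+1, 2) =
    \sum_(0 <= k < 2 * n) x ^+ 'C(k.+1, 2)
    + x ^+ (n * (2 * n + 1)) + x ^+ (n * (2 * n + 1) + (2 * n + 1)).
  rewrite (_ : 2 * n.+1 = (2 * n).+2)%N; last by lia.
  rewrite big_nat_recr // big_nat_recr //=.
  by congr (_ + x ^+ _ + x ^+ _); rewrite bin2 /=; lia.
rewrite big_nat_recr //= /U muln0 subrr !mul0r subr0.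
rewrite [evens n n]big_geq // big_nat1.
have -> : (n * (2 * n.+1 + 1) = n * (2 * n + 1) + 2 * n)%N by lia.
rewrite !exprD expr1.
ring.
Qed.

End Shanks.

(** * The form [x^2 + 3 y^2] *)

Lemma sum_involution (I : finType) (h : I -> I) (P : pred I) :
    (forall i, P i -> P (h i)) -> (forall i, P i -> h (h i) = i) ->
  \sum_(i | P i) (1 : 'F_2) = \sum_(i | P i && (h i == i)) 1.
Proof.
move=> hP hK; rewrite (bigID (fun i => h i == i)) /=.
(* [enum_rank] selects one point of each pair [{i, h i}]; [h] exchanges the two halves, whose sums
   cancel in ['F_2]. *)
rewrite [X in _ + X](bigID (fun i => enum_rank i < enum_rank (h i))%N) /=.
rewrite [X in _ + (_ + X)](reindex_onto h h) /=; last first.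
  by move=> i /andP[/andP[Pi _] _]; apply: hK.
rewrite [X in _ + (_ + X)](eq_bigl
  (fun i => P i && (h i != i) && (enum_rank i < enum_rank (h i))%N)) => [|i].
  by rewrite addFF addr0.
apply/idP/idP.
  case/andP=> /andP[/andP[Phi ne] lt] /eqP hi.
  have Pi : P i by rewrite -hi; apply: hP.
  move: ne lt; rewrite hi Pi eq_sym => ne; rewrite ne /= -leqNgt => le.
  rewrite ltn_neqAle le andbT; apply: contra ne => /eqP/val_inj/enum_rank_inj <-.
  by [].
case/andP=> /andP[Pi ne] lt.
by rewrite hP // hK // eqxx andbT eq_sym ne /= -leqNgt ltnW.
Qed.

(* In terms of [x = 2i+1], [y = 2j+1]: [(x, y)] goes to
   [(|x - 3ey| / 2, |x + ey| / 2)], the sign [e] making both entries odd. *)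
Definition rotl i j : nat :=
  if odd (i + j) then (i + 3 * j + 1)./2 else (i - (3 * j + 1) + (3 * j + 1 - i))./2.
Definition rotr i j : nat :=
  if odd (i + j) then ((i - j) + (j - i))./2 else (i + j)./2.

(** The rotation parametrised without subtraction or halving. Reversal preserves [RotA] and swaps
    [RotB] with [RotC] and [RotD] with [RotE], so the involution can be read off. *)
Variant rot_spec : nat -> nat -> nat -> nat -> Prop :=
| RotA j d : rot_spec (j + 2 * d + 1) j (d + 2 * j + 1) d
| RotB i d : rot_spec i (2 * d + 1 + i) (3 * d + 2 + 2 * i) d
| RotC j d : rot_spec (3 * j + 2 + 2 * d) j d (2 * j + 1 + d)
| RotD i d : rot_spec (3 * d + i) (d + i) i (2 * d + i)
| RotE i d : rot_spec i (2 * d + i) (3 * d + i) (d + i).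

Lemma rotP i j : rot_spec i j (rotl i j) (rotr i j).
Proof.
have casts i' j' a b : i' = i -> j' = j -> a = rotl i j -> b = rotr i j ->
  rot_spec i' j' a b -> rot_spec i j (rotl i j) (rotr i j) by move=> -> -> -> ->.
case odd_ij: (odd (i + j)).
  have [le_ji|lt_ij] := leqP j i.
    by apply: casts (RotA j (i - j)./2); rewrite /rotl /rotr ?odd_ij; lia.
  by apply: casts (RotB i (j - i)./2); rewrite /rotl /rotr ?odd_ij; lia.
have [le_ji|lt_ij] := leqP j i.
  have [lt3|le3] := leqP (3 * j + 1) i.
    by apply: casts (RotC j (i - (3 * j + 1))./2); rewrite /rotl /rotr ?odd_ij; lia.
  (* Here [i <= 3j], so [(i - j) / 2 <= j] and the subtraction is exact. *)
  by apply: casts (RotD (j - (i - j)./2) (i - j)./2); rewrite /rotl /rotr ?odd_ij; lia.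
by apply: casts (RotE i (j - i)./2); rewrite /rotl /rotr ?odd_ij; lia.
Qed.

Lemma rot_spec_sym i j a b : rot_spec i j a b -> rot_spec a b i j.
Proof. by case=> *; constructor. Qed.

Lemma rot_specE i j a b : rot_spec i j a b -> rotl i j = a /\ rotr i j = b.
Proof.
by case=> [k d|k d|k d|k d|k d]; rewrite /rotl /rotr; case: ifP => ?; split; lia.
Qed.

Lemma rotK i j :
  rotl (rotl i j) (rotr i j) = i /\ rotr (rotl i j) (rotr i j) = j.
Proof. exact: rot_specE (rot_spec_sym (rotP i j)). Qed.

Lemma rot_fix i j :
  (rotl i j == i) && (rotr i j == j) = (i == j) || (i == 3 * j + 1)%N.
Proof. by case: rotP => *; apply/idP/idP; lia. Qed.

Lemma double_bin2 n : (2 * 'C(n.+1, 2) = n * n + n)%N.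
Proof. by rewrite bin2 /= mul2n even_halfK ?oddM /= ?andNb // mulSn addnC. Qed.

(** The rotation preserves [x^2 + 3 y^2], which equals 8 times this sum plus 4. *)
Lemma rot_norm i j :
  ('C((rotl i j).+1, 2) + 3 * 'C((rotr i j).+1, 2) = 'C(i.+1, 2) + 3 * 'C(j.+1, 2))%N.
Proof.
have := (double_bin2 (rotl i j), double_bin2 (rotr i j), double_bin2 i, double_bin2 j).
by case: rotP => [k d|k d|k d|k d|k d] [[[]]]; lia.
Qed.

(** Gauss's series [a], exact below the exponent [M(M+1)/2]. *)
Definition tri_poly (M : nat) : {poly 'F_2} := \sum_(i < M) 'X^('C(i.+1, 2)).

Lemma leq_bin2 n : (n <= 'C(n.+1, 2))%N.
Proof. by have := double_bin2 n; nia. Qed.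

Lemma coef_tri_polyM3 M m :
  (tri_poly M * (tri_poly M \Po 'X^3))`_m =
  \sum_(p : 'I_M * 'I_M | ('C(p.1.+1, 2) + 3 * 'C(p.2.+1, 2) == m)%N) 1.
Proof.
rewrite /tri_poly (raddf_sum (comp_poly 'X^3)) big_distrlr pair_big /= coef_sum.
rewrite [RHS]big_mkcond; apply: eq_bigr => -[i j] _ /=.
rewrite comp_Xn_poly -exprM -exprD coefXn eq_sym.
by case: eqP.
Qed.

Lemma coef_tri_poly_pow4 M m :
  (tri_poly M ^+ 4 + 'X * (tri_poly M \Po 'X^3) ^+ 4)`_m =
  \sum_(j < M | (4 * 'C(j.+1, 2) == m)%N) 1
  + \sum_(j < M | (12 * 'C(j.+1, 2) + 1 == m)%N) 1.
Proof.
have pow4 (p : {poly 'F_2}) : p ^+ 4 = p \Po 'X^4.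
  rewrite -[4%N]/(2 * 2)%N exprM (sqr_comp_polyX2 p) sqr_comp_polyX2.
  by rewrite -comp_polyA comp_Xn_poly -exprM.
rewrite (pow4 (tri_poly M)) (pow4 (_ \Po _)) -comp_polyA comp_Xn_poly -exprM.
rewrite /tri_poly !(raddf_sum (comp_poly _)) /= big_distrr /= coefD !coef_sum.
congr (_ + _); rewrite [RHS]big_mkcond; apply: eq_bigr => i _.
  by rewrite comp_Xn_poly -exprM coefXn eq_sym; case: eqP.
by rewrite comp_Xn_poly -exprM -exprS coefXn addn1 eq_sym; case: eqP.
Qed.

(* The fixed points [i = j] and [i = 3j + 1] give the two terms on the right. *)
Lemma tri_poly_eq M m : (m < M)%N ->
  (tri_poly M * (tri_poly M \Po 'X^3))`_m =
  (tri_poly M ^+ 4 + 'X * (tri_poly M \Po 'X^3) ^+ 4)`_m.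
Proof.
case: M => // M lt_mM; rewrite coef_tri_poly_pow4 coef_tri_polyM3.
pose rot (p : 'I_M.+1 * 'I_M.+1) : 'I_M.+1 * 'I_M.+1 :=
  (inord (rotl p.1 p.2), inord (rotr p.1 p.2)).
(* [inord] is faithful: each new coordinate is at most its triangular number, hence at most [m]. *)
have rotE (p : 'I_M.+1 * 'I_M.+1) :
    ('C(p.1.+1, 2) + 3 * 'C(p.2.+1, 2) == m)%N ->
    ((rot p).1 = rotl p.1 p.2 :> nat) * ((rot p).2 = rotr p.1 p.2 :> nat).
  rewrite -rot_norm => /eqP norm_p.
  have := (leq_bin2 (rotl p.1 p.2), leq_bin2 (rotr p.1 p.2)) => -[lel ler].
  by split; rewrite /= inordK //; lia.
rewrite (sum_involution (h := rot)); first last.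
- move=> [i j] /= norm_ij; have [El Er] := rotE (i, j) norm_ij.
  rewrite {1}/rot El Er; have [-> ->] := rotK i j.
  by rewrite !inord_val.
- by move=> p norm_p; rewrite !rotE // rot_norm.
rewrite (eq_bigl (fun p : 'I_M.+1 * 'I_M.+1 =>
  ('C(p.1.+1, 2) + 3 * 'C(p.2.+1, 2) == m)%N &&
  ((p.1 == p.2 :> nat) || (p.1 == 3 * p.2 + 1 :> nat)%N))); last first.
  by move=> p /=; apply: andb_id2l => norm_p; rewrite -rot_fix -!rotE //.
rewrite (bigID (fun p : 'I_M.+1 * 'I_M.+1 => p.1 == p.2 :> nat)) /=.
congr (_ + _).
  rewrite (reindex_onto (fun j : 'I_M.+1 => (j, j)) snd) /=; last first.
    by move=> [i j] /= /andP[_ /eqP/val_inj ->].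
  by apply: eq_bigl => j; rewrite !eqxx /= !andbT; congr (_ == _); lia.
rewrite (reindex_onto (fun j : 'I_M.+1 => (inord (3 * j + 1), j)) snd) /=; last first.
  move=> [i j] /= /andP[/andP[_ ij] ne_ij]; congr (_, _).
  by apply: val_inj; rewrite /= inordK; have := ltn_ord i; lia.
apply: eq_bigl => j; rewrite eqxx andbT.
(* At [x = 3y] the form is [12 y^2], which produces the exponent [12 C(j+1,2) + 1] of [q b^4]. *)
have tri3 : ('C((3 * j + 1).+1, 2) = 9 * 'C(j.+1, 2) + 1)%N.
  by have := (double_bin2 (3 * j + 1), double_bin2 j) => -[]; lia.
have [lt_jM|le_Mj] := ltnP (3 * j + 1) M.+1.
  rewrite inordK // tri3; apply/idP/idP; lia.
(* Now [3j + 1] is out of range and [inord] takes its default value; the conditions on both sides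
   fail. *)
have lt_m : (m < 12 * 'C(j.+1, 2) + 1)%N.
  by have := leq_bin2 (3 * j + 1); rewrite tri3; lia.
rewrite [RHS]gtn_eqF //; apply/negP => /andP[/andP[norm_ij ij] ne_ij].
suff : (3 * j + 1 < M.+1)%N by lia.
have := ltn_ord (inord (3 * j + 1) : 'I_M.+1); lia.
Qed.

(** * Reduction of the eta quotients *)

Definition red2 (p : {poly int}) : {poly 'F_2} := map_poly intr p.

Local Notation eul k N := (red2 (qpoch_tr k N)).
Local Notation euli k N := (red2 (qpochinv_tr k N)).

Lemma eulE k N : eul k N = \prod_(1 <= j < N.+1) (1 - 'X^(k * j)).
Proof.
rewrite /red2 rmorph_prod /=; apply: eq_bigr => j _.
by rewrite rmorphB rmorph1 /= map_polyXn.
Qed.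

Lemma euliE k N :
  euli k N = \prod_(1 <= j < N.+1) \sum_(i < N.+1) 'X^(k * j * i).
Proof.
rewrite /red2 rmorph_prod /=; apply: eq_bigr => j _.
by rewrite rmorph_sum /=; apply: eq_bigr => i _; rewrite map_polyXn.
Qed.

Lemma eul_comp k N : eul k N = eul 1 N \Po 'X^k.
Proof.
rewrite !eulE (rmorph_prod (comp_poly 'X^k)); apply: eq_bigr => j _.
by rewrite rmorphB rmorph1 /= comp_Xn_poly -exprM mul1n.
Qed.

Lemma eul_double k N : eul (2 * k) N = eul k N ^+ 2.
Proof.
rewrite (eul_comp (2 * k)) (eul_comp k) sqr_comp_polyX2.
by rewrite -comp_polyA comp_Xn_poly -exprM.
Qed.

(** Each factor telescopes as a finite geometric sum to [1 - q^(kj(N+1))], which is 1 modulo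
    [q^(N+1)]. *)
Lemma trunc_eul_euli N k : (0 < k)%N ->
  trunc N (eul k N) * trunc N (euli k N) = 1.
Proof.
move=> k_gt0; rewrite -rmorphM eulE euliE -big_split /= rmorph_prod.
rewrite big_nat big1 // => j /andP[j_gt0 _].
have -> : (1 - 'X^(k * j)) * \sum_(i < N.+1) 'X^(k * j * i)
    = 1 - 'X^(k * j * N.+1) :> {poly 'F_2}.
  rewrite (exprM _ (k * j) N.+1) -[X in _ = X - _](expr1n _ N.+1) subrXX; congr (_ * _).
  by apply: eq_bigr => i _; rewrite expr1n mul1r exprM.
rewrite rmorphB rmorph1 /= truncXn ?subr0 //.
by rewrite leq_pmull // muln_gt0 k_gt0.
Qed.

Lemma trunc_eul n N : (n <= N)%N -> trunc n (eul 1 N) = trunc n (eul 1 n).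
Proof.
move=> le_nN; rewrite !eulE (big_cat_nat _ (n := n.+1)) //= rmorphM.
rewrite [X in _ * X](_ : _ = 1) ?mulr1 //.
rewrite rmorph_prod big_nat big1 // => j /andP[lt_nj _].
by rewrite rmorphB rmorph1 /= mul1n truncXn // subr0.
Qed.

Lemma odds_evens n :
  (\prod_(0 <= k < n) (1 - 'X^(2 * k + 1))) * \prod_(0 <= k < n) (1 - 'X^(2 * k + 2))
  = eul 1 (2 * n).
Proof.
rewrite eulE big_add1 /=; elim: n => [|n IHn]; first by rewrite !big_geq ?mulr1.
have -> : (2 * n.+1 = (2 * n).+2)%N by lia.
rewrite !(big_nat_recr, IHn) //= -IHn !mul1n !(addn1, addn2).
by rewrite mulrACA mulrA.
Qed.

Lemma evensE n : \prod_(0 <= k < n) (1 - 'X^(2 * k + 2)) = eul 1 n ^+ 2.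
Proof.
rewrite -eul_double eulE big_add1 /=; apply: eq_bigr => k _.
by congr (1 - 'X^_); lia.
Qed.

(** Modulo 2 the even factors give [f_1^2], so the odd ones give [1 / f_1], and Gauss's quotient of
    even by odd factors is [f_1^3]. *)
Lemma trunc_tri_poly N : (0 < N)%N ->
  trunc N (eul 1 N ^+ 3) = trunc N (tri_poly (2 * N)).
Proof.
move=> N_gt0.
have trE : trunc N (tri_poly (2 * N)) *
    trunc N (\prod_(0 <= k < N) (1 - 'X^(2 * k + 1))) = trunc N (eul 1 N) ^+ 2.
  rewrite -rmorphM /tri_poly -(big_mkord xpredT (fun k => 'X^('C(k.+1, 2)))).
  rewrite shanks big_ltn // rmorphD [X in _ + X]rmorph_sum.
  rewrite [X in _ + X]big_nat [X in _ + X]big1 => [|s /andP[s_gt0 _]].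
    by rewrite addr0 (big_geq (leqnn 0)) mul0n expr0 !mulr1 evensE rmorphXn.
  rewrite rmorphM /= truncXn ?mulr0 //.
  by nia.
have := odds_evens N; rewrite evensE => /(congr1 (trunc N)).
rewrite rmorphM rmorphXn /= trunc_eul ?leq_pmull // => odE.
have fg := trunc_eul_euli N (isT : 0 < 1)%N.
rewrite rmorphXn /=; move: trE odE fg.
set f := trunc N (eul 1 N); set o := trunc N (\prod_(_ <= _ < _) _).
move=> trE odE fg.
have -> : f ^+ 3 = f ^+ 2 * f ^+ 2 * trunc N (euli 1 N).
  by rewrite -[LHS]mulr1 -fg; ring.
by rewrite -{1}trE -(mulrA _ o) odE -mulrA fg mulr1.
Qed.

Lemma trunc_tri_poly3 N : (0 < N)%N ->
  trunc N (eul 3 N ^+ 3) = trunc N (tri_poly (2 * N) \Po 'X^3).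
Proof.
move=> N_gt0; rewrite eul_comp -rmorphXn /=; apply/truncP=> i le_iN.
rewrite !coef_comp_poly_Xn //; case: ifP => // _.
have /truncP-> // := trunc_tri_poly N_gt0.
by apply: leq_trans le_iN; apply: leq_div.
Qed.

(** This is [a b = a^4 + q b^4] with [a = f_1^3] and [b = f_3^3]. *)
Lemma trunc_cubes N : (0 < N)%N ->
  (trunc N (eul 1 N) * trunc N (eul 3 N)) ^+ 3 =
  trunc N (eul 1 N) ^+ 12 + trunc N 'X * trunc N (eul 3 N) ^+ 12.
Proof.
move=> N_gt0.
have a3 : trunc N (eul 1 N) ^+ 3 = trunc N (tri_poly (2 * N)).
  by rewrite -trunc_tri_poly // rmorphXn.
have b3 : trunc N (eul 3 N) ^+ 3 = trunc N (tri_poly (2 * N) \Po 'X^3).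
  by rewrite -trunc_tri_poly3 // rmorphXn.
rewrite exprMn -[12%N]/(3 * 4)%N !exprM a3 b3 -!rmorphXn -!rmorphM -rmorphD /=.
apply/truncP=> i le_iN; rewrite (rmorphXn (comp_poly 'X^3)) /=.
by apply: tri_poly_eq; lia.
Qed.

(** * Eta quotients over a ring, with [g1 = 1 / f1] and [g3 = 1 / f3] *)

Section EtaQuotients.
Variables (R : comPzRingType) (x f1 f3 g1 g3 : R).
Hypotheses (fg1 : f1 * g1 = 1) (fg3 : f3 * g3 = 1).
Hypothesis cubes : (f1 * f3) ^+ 3 = f1 ^+ 12 + x * f3 ^+ 12.

(** With [f_2 = f_1^2] and [f_6 = f_3^2] the left side is [a / b^3]; divide [cubes] by [b^4]. *)
Lemma eta_quotient_P :
  (f1 ^+ 2 * f3 ^+ 3 * g1 * (g3 ^+ 2) ^+ 3) ^+ 3 = (f1 ^+ 3 * g3 ^+ 3) ^+ 4 + x.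
Proof.
transitivity ((f1 * g1) ^+ 3 * (f3 * g3) ^+ 6 * ((f1 * f3) ^+ 3) * g3 ^+ 12).
  by ring.
rewrite cubes fg1 fg3.
transitivity ((f1 ^+ 3 * g3 ^+ 3) ^+ 4 + x * (f3 * g3) ^+ 12); first by ring.
by rewrite fg3; ring.
Qed.

(** Divide [cubes] by [(a b)^2], then square. *)
Lemma eta_quotient_A :
  (f1 * f3 * g1 ^+ 2 * g3 ^+ 2) ^+ 6 =
  ((f1 ^+ 3 * g3 ^+ 3) ^+ 2 + x * (f3 ^+ 3 * g1 ^+ 3) ^+ 2) ^+ 2.
Proof.
transitivity (((f1 * f3) ^+ 3 * g1 ^+ 6 * g3 ^+ 6) ^+ 2); first by ring.
rewrite cubes; congr (_ ^+ 2).
transitivity ((f1 * g1) ^+ 6 * (f1 ^+ 3 * g3 ^+ 3) ^+ 2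
              + x * (f3 * g3) ^+ 6 * (f3 ^+ 3 * g1 ^+ 3) ^+ 2); first by ring.
by rewrite fg1 fg3; ring.
Qed.

(** Divide [cubes] by [b^2]. *)
Lemma eta_quotient_W :
  f1 ^+ 3 * g3 ^+ 3 = (f1 ^+ 6 * g3 ^+ 3) ^+ 2 + x * (f3 ^+ 3) ^+ 2.
Proof.
transitivity ((f3 * g3) ^+ 3 * (f1 ^+ 3 * g3 ^+ 3)); first by rewrite fg3; ring.
transitivity ((f1 * f3) ^+ 3 * g3 ^+ 6); first by ring.
rewrite cubes.
transitivity ((f1 ^+ 6 * g3 ^+ 3) ^+ 2 + x * (f3 * g3) ^+ 6 * (f3 ^+ 3) ^+ 2).
  by ring.
by rewrite fg3; ring.
Qed.

(** Divide [cubes] by [a^2]. *)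
Lemma eta_quotient_V :
  f3 ^+ 3 * g1 ^+ 3 = (f1 ^+ 3) ^+ 2 + x * (f3 ^+ 6 * g1 ^+ 3) ^+ 2.
Proof.
transitivity ((f1 * g1) ^+ 3 * (f3 ^+ 3 * g1 ^+ 3)); first by rewrite fg1; ring.
transitivity ((f1 * f3) ^+ 3 * g1 ^+ 6); first by ring.
rewrite cubes.
transitivity ((f1 * g1) ^+ 6 * (f1 ^+ 3) ^+ 2 + x * (f3 ^+ 6 * g1 ^+ 3) ^+ 2).
  by ring.
by rewrite fg1; ring.
Qed.

End EtaQuotients.

(** * Coefficients by residue class of the exponent *)

Section Coefficients.
Variable N : nat.
Hypothesis N_gt0 : (0 < N)%N.

Let W := eul 1 N ^+ 3 * euli 3 N ^+ 3.
Let V := eul 3 N ^+ 3 * euli 1 N ^+ 3.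

Let fg1 := trunc_eul_euli N (isT : 0 < 1)%N.
Let fg3 := trunc_eul_euli N (isT : 0 < 3)%N.
Let cubes := trunc_cubes N_gt0.

(** Uniqueness of inverses: both sides invert [f_(2k) = f_k^2]. *)
Lemma trunc_euli_double k : (0 < k)%N ->
  trunc N (euli (2 * k) N) = trunc N (euli k N) ^+ 2.
Proof.
move=> k_gt0; have fg := trunc_eul_euli N k_gt0.
have k2_gt0 : (0 < 2 * k)%N by rewrite muln_gt0.
have := trunc_eul_euli N k2_gt0.
rewrite eul_double rmorphXn /=; move: fg.
set f := trunc N (eul k N); set g := trunc N (euli k N) => fg fg'.
by rewrite -[LHS]mulr1 -(expr1n _ 2) -fg exprMn mulrA [_ * f ^+ 2]mulrC fg' mul1r.
Qed.

(** Read off from [W^4 + q], where [W^4] is a series in [q^4]. *)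
Lemma coef_P6 i : (i <= N)%N ->
  (red2 (P6_tr N))`_i = (if (4 %| i)%N then W`_(i %/ 4) else 0) + (i == 1%N)%:R.
Proof.
move=> le_iN; rewrite -coefX.
rewrite -coef_pow4 -coefD; move: i le_iN; apply/truncP.
have -> : red2 (P6_tr N) =
    (eul (2 * 1) N * eul 3 N ^+ 3 * euli 1 N * euli (2 * 3) N ^+ 3) ^+ 3.
  by rewrite /red2 /P6_tr !(rmorphXn, rmorphM).
rewrite eul_double !(rmorphXn, rmorphM, rmorphD) /= trunc_euli_double //.
exact: eta_quotient_P fg1 fg3 cubes.
Qed.

(** Read off from [W^4 + q^2 V^4]; at an exponent [4k + 2] the floor [i %/ 4] is [k]. *)
Lemma coef_A6 i : (i <= N)%N ->
  (red2 (A6_tr N))`_i =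
  if (4 %| i)%N then W`_(i %/ 4) else
  if (4 %| i + 2)%N then V`_(i %/ 4) else 0.
Proof.
move=> le_iN; transitivity (((W ^+ 2 + 'X * V ^+ 2) ^+ 2)`_i).
  move: i le_iN; apply/truncP.
  have -> : red2 (A6_tr N) =
      (eul 1 N * eul 3 N * euli (2 * 1) N * euli (2 * 3) N) ^+ 6.
    by rewrite /red2 /A6_tr !(rmorphXn, rmorphM).
  rewrite !(rmorphXn, rmorphM, rmorphD) /= !trunc_euli_double //.
  exact: eta_quotient_A fg1 fg3 cubes.
rewrite coef_sqr coefD coefXM !coef_sqr.
case: (boolP (2 %| i)%N) => [/dvdnP[j ->]|ndvd2]; last by rewrite !ifN //; lia.
rewrite mulnK //.
case: (boolP (2 %| j)%N) => [/dvdnP[k ->]|ndvd2].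
  have -> : (4 %| k * 2 * 2)%N by lia.
  have -> : (k * 2 * 2 %/ 4 = k)%N by lia.
  rewrite mulnK //; case: ifP => [|ne0]; first by rewrite addr0.
  by rewrite ifN ?addr0 //; lia.
rewrite add0r; have [k ->] : exists k, j = (2 * k + 1)%N by exists (j %/ 2)%N; lia.
rewrite ifN; last by lia.
rewrite ifT; last by lia.
rewrite ifN; last by lia.
rewrite ifT; last by lia.
by congr (V`_ _); lia.
Qed.

(** The odd part of [W] is [q b^2 = q b(q^2)], and [b = a(q^3)]. *)
Lemma coef_W i : (2 * i + 1 <= N)%N ->
  W`_(2 * i + 1) = if (3 %| i)%N then (eul 1 N ^+ 3)`_(i %/ 3) else 0.
Proof.
move=> le_iN.
transitivity (((eul 1 N ^+ 6 * euli 3 N ^+ 3) ^+ 2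
               + 'X * (eul 3 N ^+ 3) ^+ 2)`_(2 * i + 1)).
  move: (2 * i + 1)%N le_iN; apply/truncP.
  rewrite !(rmorphXn, rmorphM, rmorphD) /=.
  exact: eta_quotient_W fg3 cubes.
rewrite coefD coefXM !coef_sqr ifN; last by lia.
rewrite add0r ifN; last by lia.
rewrite ifT; last by lia.
have -> : ((2 * i + 1).-1 %/ 2 = i)%N by lia.
by rewrite eul_comp -(rmorphXn (comp_poly 'X^3)) /= coef_comp_poly_Xn.
Qed.

Lemma coef_V i : (2 * i <= N)%N -> V`_(2 * i) = (eul 1 N ^+ 3)`_i.
Proof.
move=> le_iN.
transitivity (((eul 1 N ^+ 3) ^+ 2
               + 'X * (eul 3 N ^+ 6 * euli 1 N ^+ 3) ^+ 2)`_(2 * i)).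
  move: (2 * i)%N le_iN; apply/truncP.
  rewrite !(rmorphXn, rmorphM, rmorphD) /=.
  exact: eta_quotient_V fg1 cubes.
rewrite coefD coefXM !coef_sqr ifT; last by lia.
rewrite mulKn //; case: ifP => [|ne0]; first by rewrite addr0.
by rewrite ifN ?addr0 //; lia.
Qed.

End Coefficients.

(** Lets coefficients taken at different truncation orders be compared, as (e) requires. *)
Lemma coef_eul_cube i N : (i <= N)%N -> (eul 1 N ^+ 3)`_i = (eul 1 i ^+ 3)`_i.
Proof.
move=> le_iN; have /truncP -> // : trunc i (eul 1 N ^+ 3) = trunc i (eul 1 i ^+ 3).
by rewrite !rmorphXn /= trunc_eul.
Qed.

(** * Parity of the coefficients of the Hauptmoduln *)

Lemma J6_mod2 n : (0 < n)%N -> (J6 n)%:~R = (red2 (P6_tr n.+1))`_n.+1.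
Proof. by case: n => // n _; rewrite /J6 subr0 coef_map. Qed.

(** The factor [q^(-1)] shifts the index by one, and the term with coefficient 64 vanishes modulo
    2. *)
Lemma J6star_mod2 n : (0 < n)%N -> (J6star n)%:~R = (red2 (A6_tr n.+1))`_n.+1.
Proof.
case: n => // n _; rewrite /J6star addr0 rmorphD rmorphM /= coef_map.
have -> : 64%:~R = 0 :> 'F_2 by apply/eqP.
by rewrite mul0r addr0.
Qed.

Theorem theorem1p5 (n : nat) (hn : (0 < n)%N) :
  [/\ (2 %| J6star (2 * n))%Z /\ (2 %| J6 (2 * n))%Z,
      (2 %| J6 (4 * n + 1))%Z,
      [/\ (2 %| J6star (24 * n + 11))%Z, (2 %| J6star (24 * n + 19))%Z,
          (2 %| J6 (24 * n + 11))%Z & (2 %| J6 (24 * n + 19))%Z],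
      (J6star (4 * n - 1) == J6 (4 * n - 1) %[mod 2])%Z
    & (J6star (8 * n + 1) == J6 (24 * n + 3) %[mod 2])%Z].
Proof.
have P0 m : (1 < m)%N -> ~~ (4 %| m)%N -> (red2 (P6_tr m))`_m = 0.
  by move=> m_gt1 ndvd; rewrite coef_P6 ?(ltnW m_gt1) // ifN // gtn_eqF // addr0.
have A0 m : odd m -> (red2 (A6_tr m))`_m = 0.
  by move=> odd_m; rewrite coef_A6 ?ifN //; lia.
(* At [q^(4i)] both series have the coefficient [W_i]; this yields (d). *)
have mod4 i : (0 < i)%N -> exists2 N, (4 * i <= N)%N &
    (red2 (P6_tr (4 * i)))`_(4 * i) = (eul 1 N ^+ 3 * euli 3 N ^+ 3)`_i
    /\ (red2 (A6_tr (4 * i)))`_(4 * i) = (eul 1 N ^+ 3 * euli 3 N ^+ 3)`_i.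
  move=> i_gt0; exists (4 * i)%N; first by [].
  rewrite coef_P6 ?coef_A6 ?muln_gt0 // dvdn_mulr // mulKn //.
  by rewrite (_ : (4 * i == 1)%N = false) ?addr0 //; lia.
(* The odd part [q a(q^6)] of [W] has no term of exponent [2i + 1] unless 3 divides [i]; this yields
   (c). *)
have vanish i : (i %% 3 != 0)%N ->
    (red2 (P6_tr (4 * (2 * i + 1))))`_(4 * (2 * i + 1)) = 0
    /\ (red2 (A6_tr (4 * (2 * i + 1))))`_(4 * (2 * i + 1)) = 0.
  move=> i3; have [|N le_N [-> ->]] := mod4 (2 * i + 1)%N; first by lia.
  by rewrite coef_W ?ifN //; lia.
split; [split | | split | |].
- by rewrite dvd2zE J6star_mod2 ?A0 //; lia.
- by rewrite dvd2zE J6_mod2 ?P0 //; lia.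
- by rewrite dvd2zE J6_mod2 ?P0 //; lia.
- rewrite dvd2zE J6star_mod2; last by lia.
  have -> : (24 * n + 11).+1 = (4 * (2 * (3 * n + 1) + 1))%N by lia.
  by have [|_ ->] := vanish (3 * n + 1)%N; first by lia.
- rewrite dvd2zE J6star_mod2; last by lia.
  have -> : (24 * n + 19).+1 = (4 * (2 * (3 * n + 2) + 1))%N by lia.
  by have [|_ ->] := vanish (3 * n + 2)%N; first by lia.
- rewrite dvd2zE J6_mod2; last by lia.
  have -> : (24 * n + 11).+1 = (4 * (2 * (3 * n + 1) + 1))%N by lia.
  by have [|-> _] := vanish (3 * n + 1)%N; first by lia.
- rewrite dvd2zE J6_mod2; last by lia.
  have -> : (24 * n + 19).+1 = (4 * (2 * (3 * n + 2) + 1))%N by lia.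
  by have [|-> _] := vanish (3 * n + 2)%N; first by lia.
- rewrite eqz_mod_dvd dvd2zE rmorphB /= J6star_mod2 ?J6_mod2; try lia.
  have -> : (4 * n - 1).+1 = (4 * n)%N by lia.
  by have [N _ [-> ->]] := mod4 n hn; rewrite subrr.
(* Both sides of (e) are the coefficient of [q^n] in [a]: exponent [8n + 2] gives [V_(2n)], and
   [24n + 4] gives [W_(6n+1)]. *)
rewrite eqz_mod_dvd dvd2zE rmorphB /= J6star_mod2 ?J6_mod2; try lia.
have -> : (24 * n + 3).+1 = (4 * (2 * (3 * n) + 1))%N by lia.
have [|N le_N [-> _]] := mod4 (2 * (3 * n) + 1)%N; first by lia.
rewrite coef_W ?dvdn_mulr ?mulKn //; try lia.
rewrite coef_A6 //.
rewrite ifN; last by lia.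
rewrite ifT; last by lia.
have -> : ((8 * n + 1).+1 %/ 4 = 2 * n)%N by lia.
rewrite coef_V; [|lia..].
by rewrite (@coef_eul_cube n) ?(@coef_eul_cube n N) ?subrr //; lia.
Qed.
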